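(* Let $N$ be a simply connected two-step nilpotent Lie group of dimension five whose Lie algebra has one-dimensional center. Then there is no left invariant Randers metric of Berwald type on $N$; that is, for no left invariant Riemannian metric $g$ on $N$ and no nonzero vector field $X$ on $N$ with $\sqrt{g(X,X)}<1$ everywhere is the Randers metric $F(x,Y)=\sqrt{g(x)(Y,Y)}+g(x)(X(x),Y)$ both left invariant and of Berwald type.
   Context: A Lie group is two-step nilpotent if its Lie algebra $\mathfrak{n}$ is non-abelian and $[\mathfrak{n},[\mathfrak{n},\mathfrak{n}]]=0$. For a Riemannian metric $g$ and a vector field $X$ on a manifold $M$ with $\sqrt{g(X,X)}<1$, the Randers metric defined by $g$ and $X$ is the Finsler metric $F(x,Y)=\sqrt{g(x)(Y,Y)}+g(x)(X(x),Y)$ for $x\in M$, $Y\in T_xM$. Such an $F$ is of Berwald type if and only if $X$ is parallel with respect to the Levi-Civita connection of $g$; this may be taken as the definition. A Finsler metric $F$ on a Lie group $G$ with unit element $e$ is left invariant if $F(a,Y)=F(e,T_a l_{a^{-1}}Y)$ for all $a\in G$, $Y\in T_aG$, where $l_{a^{-1}}$ is left translation by $a^{-1}$. A left invariant Riemannian metric is one for which all left translations are isometries. *)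

(* Defs.v *)
From HB Require Import structures.
From mathcomp Require Import all_boot all_order all_algebra.
From mathcomp Require Import all_classical all_reals.
From mathcomp Require Import topology normedtype derive.

Set Implicit Arguments.
Unset Strict Implicit.
Unset Printing Implicit Defensive.

Import Order.TTheory GRing.Theory Num.Theory.
Import numFieldNormedType.Exports.

Local Open Scope classical_set_scope.
Local Open Scope ring_scope.

(* Meant for an open set U: the derivatives are taken in the ambient space. *)
Fixpoint Ck_on (R : realType) (m k : nat) (U : set 'rV[R]_m)
    (f : 'rV[R]_m -> R) : Prop :=
  match k with
  | 0%N => forall x, U x -> {for x, continuous f}
  | k'.+1 => (forall x, U x -> differentiable f x) /\
             (forall i : 'I_m, Ck_on k' U (fun x => 'D_(delta_mx 0 i) f x))
  end.

Definition smooth_on (R : realType) (m : nat) (U : set 'rV[R]_m)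
    (f : 'rV[R]_m -> R) : Prop := forall k, Ck_on k U f.

(* A chart is a homeomorphism [coord] from the open set [dom] onto an open
   subset of R^n.  It and its inverse [param] are total functions, whose values
   outside [dom] and outside [coord @` dom] are irrelevant. *)
Record chart (R : realType) (n : nat) (M : Type) := Chart {
  dom : set M;
  coord : M -> 'rV[R]_n;
  param : 'rV[R]_n -> M
}.

Definition is_chart (R : realType) (n : nat) (M : topologicalType)
    (c : chart R n M) : Prop :=
  [/\ open (dom c), open (coord c @` dom c),
      forall p, dom c p -> param c (coord c p) = p,
      forall p, dom c p -> {for p, continuous (coord c)} &
      forall x, (coord c @` dom c) x -> {for x, continuous (param c)}].

Definition smooth_map (R : realType) (m n : nat) (M M' : topologicalType)
    (A : set (chart R m M)) (B : set (chart R n M')) (f : M -> M') : Prop :=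
  continuous f /\
  forall c d, A c -> B d -> forall j : 'I_n,
    smooth_on (coord c @` (dom c `&` f @^-1` dom d))
      (fun x => coord d (f (param c x)) 0 j).

Definition is_smooth_atlas (R : realType) (n : nat) (M : topologicalType)
    (A : set (chart R n M)) : Prop :=
  [/\ forall c, A c -> is_chart c,
      forall p, exists2 c, A c & dom c p &
      forall c d, A c -> A d -> forall j : 'I_n,
        smooth_on (coord c @` (dom c `&` dom d))
          (fun x => coord d (param c x) 0 j)].

Definition prod_chart (R : realType) (m n : nat) (M M' : Type)
    (c : chart R m M) (d : chart R n M') : chart R (m + n) (M * M')%type :=
  Chart (dom c `*` dom d)
    (fun z => row_mx (coord c z.1) (coord d z.2))
    (fun x => (param c (lsubmx x), param d (rsubmx x))).

Definition prod_atlas (R : realType) (m n : nat) (M M' : Type)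
    (A : set (chart R m M)) (B : set (chart R n M')) :
    set (chart R (m + n) (M * M')%type) :=
  [set e | exists c d, [/\ A c, B d & e = prod_chart c d]].

HB.mixin Record Topological_isManifold (R : realType) (n : nat) M
    of Topological M := {
  atlas : set (chart R n M);
  atlasP : is_smooth_atlas atlas;
  manifold_hausdorff : hausdorff_space M;
  manifold_second_countable : @second_countable M
}.

#[short(type="manifoldType")]
HB.structure Definition Manifold (R : realType) (n : nat) :=
  { M of Topological_isManifold R n M & Topological M }.

HB.mixin Record ManifoldGroup_isLieGroup (R : realType) (n : nat) G
    of Manifold R n G & Group G := {
  mulg_smooth : smooth_map (prod_atlas (@atlas R n G) (@atlas R n G))
    (@atlas R n G) (fun z : G * G => (z.1 * z.2)%g);
  invg_smooth : smooth_map (@atlas R n G) (@atlas R n G)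
    (fun x : G => (x^-1)%g)
}.

#[short(type="lieGroupType")]
HB.structure Definition LieGroup (R : realType) (n : nat) :=
  { G of ManifoldGroup_isLieGroup R n G & Manifold R n G & Group G }.

Definition simply_connected (R : realType) (T : topologicalType) : Prop :=
  (forall x y : T, exists p : R -> T,
     [/\ {within `[0, 1], continuous p}, p 0 = x & p 1 = y]) /\
  (forall p : R -> T, {within `[0, 1], continuous p} -> p 0 = p 1 ->
     exists H : R * R -> T,
       [/\ {within `[0, 1] `*` `[0, 1], continuous H},
           forall t, t \in `[0, 1] -> H (0, t) = p t,
           forall t, t \in `[0, 1] -> H (1, t) = p 0 &
           forall s, s \in `[0, 1] -> H (s, 0) = p 0 /\ H (s, 1) = p 0]).

Section TangentBundle.
Variables (R : realType) (n : nat) (M : manifoldType R n).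

Definition smooth_fun (f : M -> R) : Prop :=
  forall c, @atlas R n M c -> smooth_on (coord c @` dom c) (f \o param c).

(* The tangent space at p is the space of derivations at p of the algebra of
   smooth real functions.  To be a plain function, a derivation takes the value
   0 at the functions that are not smooth: equality of tangent vectors is then
   equality of functions. *)
Definition tvec : Type := (M -> R) -> R^o.

Definition tangent_space (p : M) : set tvec :=
  [set v | [/\ forall f, ~ smooth_fun f -> v f = 0,
      forall (a : R) f h, smooth_fun f -> smooth_fun h ->
        v (fun q => a * f q + h q) = a * v f + v h &
      forall f h, smooth_fun f -> smooth_fun h ->
        v (fun q => f q * h q) = v f * h p + f p * v h]].

Definition smooth_vector_field (X : M -> tvec) : Prop :=
  (forall p, tangent_space p (X p)) /\
  (forall f, smooth_fun f -> smooth_fun (fun p => X p f)).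

Definition lie_bracket (X Y : M -> tvec) : M -> tvec :=
  fun p f => X p (fun q => Y q f) - Y p (fun q => X q f).

(* Only the values g p u v with u and v in [tangent_space p] are meaningful. *)
Definition riemannian_metric (g : M -> tvec -> tvec -> R) : Prop :=
  [/\ forall p u v, tangent_space p u -> tangent_space p v ->
        g p u v = g p v u,
      forall p (a : R) u v w, tangent_space p u -> tangent_space p v ->
        tangent_space p w -> g p (a *: u + v) w = a * g p u w + g p v w,
      forall p v, tangent_space p v -> v <> 0 -> 0 < g p v v &
      forall X Y, smooth_vector_field X -> smooth_vector_field Y ->
        smooth_fun (fun p => g p (X p) (Y p))].

Definition affine_connection
    (nabla : (M -> tvec) -> (M -> tvec) -> (M -> tvec)) : Prop :=
  [/\ forall X Y, smooth_vector_field X -> smooth_vector_field Y ->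
        smooth_vector_field (nabla X Y),
      forall f X X' Y, smooth_fun f -> smooth_vector_field X ->
        smooth_vector_field X' -> smooth_vector_field Y ->
        nabla (fun p => f p *: X p + X' p) Y =
        (fun p => f p *: nabla X Y p + nabla X' Y p),
      forall X Y Y', smooth_vector_field X -> smooth_vector_field Y ->
        smooth_vector_field Y' ->
        nabla X (fun p => Y p + Y' p) = (fun p => nabla X Y p + nabla X Y' p) &
      forall f X Y, smooth_fun f -> smooth_vector_field X ->
        smooth_vector_field Y ->
        nabla X (fun p => f p *: Y p) =
        (fun p => X p f *: Y p + f p *: nabla X Y p)].

Definition levi_civita (g : M -> tvec -> tvec -> R)
    (nabla : (M -> tvec) -> (M -> tvec) -> (M -> tvec)) : Prop :=
  [/\ affine_connection nabla,
      forall X Y, smooth_vector_field X -> smooth_vector_field Y ->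
        (fun p => nabla X Y p - nabla Y X p) = lie_bracket X Y &
      forall X Y Z, smooth_vector_field X -> smooth_vector_field Y ->
        smooth_vector_field Z -> forall p,
        X p (fun q => g q (Y q) (Z q)) =
        g p (nabla X Y p) (Z p) + g p (Y p) (nabla X Z p)].

(* The Levi-Civita connection of a Riemannian metric exists and is unique, so
   [nabla] below is that connection. *)
Definition parallel (g : M -> tvec -> tvec -> R) (X : M -> tvec) : Prop :=
  exists2 nabla, levi_civita g nabla &
    forall Y, smooth_vector_field Y -> nabla Y X = (fun=> 0).

Definition randers (g : M -> tvec -> tvec -> R) (X : M -> tvec) :
    M -> tvec -> R :=
  fun p v => Num.sqrt (g p v v) + g p (X p) v.

(* The characterization of Berwald type by a parallel field, as a definition;
   g and X are determined by the Randers metric. *)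
Definition randers_berwald (g : M -> tvec -> tvec -> R) (X : M -> tvec) :
    Prop := parallel g X.

End TangentBundle.

Section LieGroup.
Variables (R : realType) (n : nat) (G : lieGroupType R n).

(* The tangent map of the left translation by a. *)
Definition dltrans (a : G) (v : tvec G) : tvec G :=
  fun f => v (fun x => f (a * x)%g).

Definition left_invariant_field (X : G -> tvec G) : Prop :=
  forall a x, X (a * x)%g = dltrans a (X x).

Definition left_invariant_metric (g : G -> tvec G -> tvec G -> R) : Prop :=
  forall a x u v, tangent_space x u -> tangent_space x v ->
    g (a * x)%g (dltrans a u) (dltrans a v) = g x u v.

Definition left_invariant_finsler (F : G -> tvec G -> R) : Prop :=
  forall a v, tangent_space a v -> F a v = F 1%g (dltrans (a^-1)%g v).

Definition lie_algebra : set (G -> tvec G) :=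
  [set X | smooth_vector_field X /\ left_invariant_field X].

(* The second clause is [n, [n, n]] = 0: the bracket is bilinear and the
   brackets of elements of n span [n, n]. *)
Definition two_step_nilpotent : Prop :=
  (exists X Y, [/\ lie_algebra X, lie_algebra Y &
                   lie_bracket X Y <> (fun=> 0)]) /\
  (forall X Y Z, lie_algebra X -> lie_algebra Y -> lie_algebra Z ->
     lie_bracket X (lie_bracket Y Z) = (fun=> 0)).

Definition lie_center : set (G -> tvec G) :=
  [set Z | lie_algebra Z /\
           forall X, lie_algebra X -> lie_bracket Z X = (fun=> 0)].

Definition one_dimensional_center : Prop :=
  exists Z, [/\ lie_center Z, Z <> (fun=> 0) &
    forall X, lie_center X -> exists a : R, X = (fun p => a *: Z p)].

End LieGroup.

Arguments lie_algebra {R n} G.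
Arguments two_step_nilpotent {R n} G.
Arguments lie_center {R n} G.
Arguments one_dimensional_center {R n} G.

(* Main.v *)
From HB Require Import structures.
From mathcomp Require Import all_boot all_order all_algebra.
From mathcomp Require Import all_classical all_reals.
From mathcomp Require Import topology normedtype landau derive.
Require Import Defs.
Set Implicit Arguments.
Unset Strict Implicit.
Import Order.TTheory GRing.Theory Num.Theory.
Import numFieldNormedType.Exports.
Local Open Scope classical_set_scope.
Local Open Scope ring_scope.

(** Write n for the Lie algebra, and suppose that the Randers metric is left
    invariant and that X is parallel for the Levi-Civita connection D.

    The field X is left invariant ([randers_left_invariant]): as g is left
    invariant, so is the linear part g(X, _) of the Randers metric, and g is
    nondegenerate.  Hence X lies in n, and for left invariant fields the Koszul
    calculus is purely algebraic, since the functions g(Y, Z) are constant.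

    On the one hand, Y g(V, X) = 0 and D_Y X = 0 give g(D_Y V, X) = 0, so that X
    is orthogonal to every bracket [Y, V] = D_Y V - D_V Y
    ([parallel_orthogonal_bracket]).  On the other hand, D_X Y = [X, Y] because
    D has no torsion, so ad X is skew for g; but (ad X)^2 = 0 in a two-step
    nilpotent algebra, and a skew operator with zero square is zero:
    |[X, Y]|^2 = - g(Y, [X, [X, Y]]) = 0.  So X is central ([parallel_central]).

    If X were not zero, it would span the one-dimensional center, which
    contains [n, n]; then [n, n] would be both spanned by X and orthogonal to X,
    hence zero, and n would be abelian ([parallel_eq0]).

    The analysis behind this algebra is that left translations map tangent
    vectors to tangent vectors, that is, that f(a x) is smooth in x when f is
    smooth ([smooth_fun_ltrans]).  This is the chain rule in charts: f(a x) is
    the composite of f, the multiplication and the slice x |-> (a, x). *)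

(** * Calculus of functions of class C^k *)

(** Differentiability is local: the first order expansion of f at x is also one
    of h. *)
Lemma near_eq_differentiable (R : numFieldType) (V W : normedModType R)
    (f h : V -> W) (x : V) :
  {near x, f =1 h} -> differentiable f x -> differentiable h x.
Proof.
move=> fh /diff_locallyP[fc /eqaddoP ho].
have hd : h \o shift x = cst (h x) + 'd f x +o_ 0 id.
  apply/eqaddoP => e e0; have := ho e e0.
  apply: filterS2; last first.
    move: fh; rewrite (near_shift 0 x) => fh; exact: fh.
  move=> y /=; rewrite subr0 => E; rewrite !fctE /= -E.
  by rewrite /cst (nbhs_singleton fh).
by apply/diff_locallyP; rewrite (diff_unique fc hd).
Qed.

Section Ck.
Variables (R : realType) (m : nat).
Implicit Types (U V : set 'rV[R]_m) (f h : 'rV[R]_m -> R).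

Lemma Ck_on_sub k U V f : U `<=` V -> Ck_on k V f -> Ck_on k U f.
Proof.
elim: k f => [|k IH] f UV /=; first by move=> fV x /UV; exact: fV.
by move=> [fV dV]; split=> [x /UV/fV//|i]; exact: IH (dV i).
Qed.

(** Since derivatives are taken in the ambient space, being C^k on a set is a
    condition on each of its points separately. *)
Lemma Ck_on_cover k U f : (forall x, U x -> Ck_on k [set x] f) -> Ck_on k U f.
Proof.
elim: k f => [|k IH] f fU /=; first by move=> x Ux; exact: (fU x Ux).
split=> [x Ux|i]; first exact: (fU x Ux).1.
by apply: IH => x Ux; exact: (fU x Ux).2.
Qed.

Lemma Ck_on_pred k U f : Ck_on k.+1 U f -> Ck_on k U f.
Proof.
elim: k f => [|k IH] f [df Df].
  by move=> x Ux; apply/differentiable_continuous/df.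
by split=> // i; apply: IH; exact: Df.
Qed.

(** Openness matters: f and h have the same derivatives at a point only if they
    agree around it. *)
Lemma Ck_on_eq k U f h : open U -> (forall x, U x -> f x = h x) ->
  Ck_on k U f -> Ck_on k U h.
Proof.
move=> oU; elim: k f h => [|k IH] f h fh.
  move=> fU x Ux; have nfh : {near x, f =1 h}.
    by move: oU; rewrite openE => /(_ x Ux); apply: filterS => y /fh.
  apply: (cvg_trans _ (cvg_trans (fU x Ux) _)).
    exact: near_eq_cvg nfh.
  by rewrite fh.
have nfh x : U x -> {near x, f =1 h}.
  by move=> Ux; move: oU; rewrite openE => /(_ x Ux); apply: filterS => y /fh.
move=> [df Df]; split=> [x Ux|i].
  exact: near_eq_differentiable (nfh x Ux) (df x Ux).
by apply: IH (Df i) => x Ux; apply: near_eq_derive; exact: nfh.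
Qed.

Lemma Ck_on_cst k U (c : R) : Ck_on k U (fun=> c).
Proof.
elim: k c => [|k IH] c /=; first by move=> x _; exact: cst_continuous.
split=> [x _|i]; first exact: differentiable_cst.
suff -> : (fun x => 'D_(delta_mx 0 i) (fun=> c) x) =
    (fun=> 0) :> ('rV[R]_m -> R).
  exact: IH.
by apply/funext => x; exact: derive_cst.
Qed.

Lemma diff_coord (x v : 'rV[R]_m) i :
  'd (fun y : 'rV[R]_m => y 0 i : R) x v = v 0 i.
Proof.
pose l (y : 'rV[R]_m) : R := y 0 i.
have lin : linear l by move=> a u w; rewrite /l !mxE.
pose L : {linear 'rV[R]_m -> R} :=
  HB.pack l (GRing.isLinear.Build _ _ _ _ l lin).
have -> : (fun y : 'rV[R]_m => y 0 i : R) = L by [].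
by rewrite diff_lin //; exact: coord_continuous.
Qed.

Lemma Ck_on_coord k U i : Ck_on k U (fun x => x 0 i).
Proof.
case: k => [|k] /=; first by move=> x _; exact: coord_continuous.
split=> [x _|j]; first exact: differentiable_coord.
suff -> : (fun x => 'D_(delta_mx 0 j) (fun y : 'rV[R]_m => y 0 i : R) x) =
    fun=> (delta_mx 0 j : 'rV[R]_m) 0 i by exact: Ck_on_cst.
apply/funext => x; rewrite deriveE; last exact: differentiable_coord.
exact: diff_coord.
Qed.

Lemma Ck_on_add k U f h : open U -> Ck_on k U f -> Ck_on k U h ->
  Ck_on k U (fun x => f x + h x).
Proof.
move=> oU; elim: k f h => [|k IH] f h.
  by move=> fU hU x Ux; apply: continuousD; [exact: fU|exact: hU].
move=> [df Df] [dh Dh]; split=> [x Ux|i].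
  by apply: differentiableD; [exact: df|exact: dh].
apply: Ck_on_eq (IH _ _ (Df i) (Dh i)) => // x Ux /=.
by rewrite -deriveD //; apply: diff_derivable; [exact: df|exact: dh].
Qed.

Lemma Ck_on_mul k U f h : open U -> Ck_on k U f -> Ck_on k U h ->
  Ck_on k U (fun x => f x * h x).
Proof.
move=> oU; elim: k f h => [|k IH] f h.
  by move=> fU hU x Ux; apply: continuousM; [exact: fU|exact: hU].
move=> Cf Ch; case: (Cf) (Ch) => [df Df] [dh Dh]; split=> [x Ux|i].
  by apply: differentiableM; [exact: df|exact: dh].
apply: (@Ck_on_eq k U (fun x => f x * 'D_(delta_mx 0 i) h x +
   h x * 'D_(delta_mx 0 i) f x)) => //.
  move=> x Ux /=.
  by rewrite [RHS]deriveM //; apply: diff_derivable; [exact: df|exact: dh].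
apply: Ck_on_add => //; apply: IH.
- exact: Ck_on_pred Cf.
- exact: Dh.
- exact: Ck_on_pred Ch.
- exact: Df.
Qed.

Lemma Ck_on_sum k U n (F : 'I_n -> 'rV[R]_m -> R) : open U ->
  (forall j, Ck_on k U (F j)) -> Ck_on k U (fun x => \sum_j F j x).
Proof.
elim: n F => [|n IH] F oU FU.
  suff -> : (fun x => \sum_j F j x) = (fun=> 0) by exact: Ck_on_cst.
  by apply/funext => x; rewrite big_ord0.
suff -> : (fun x => \sum_j F j x) =
    fun x => F ord0 x + \sum_(j < n) F (lift ord0 j) x.
  by apply: Ck_on_add => //; apply: IH.
by apply/funext => x; rewrite big_ord_recl.
Qed.

End Ck.

Section Composition.
Variables (R : realType) (m n : nat).

Lemma differentiable_row (phi : 'rV[R]_m -> 'rV[R]_n) x :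
  (forall j, differentiable (fun y => phi y 0 j) x) -> differentiable phi x.
Proof.
move=> dphi.
rewrite (_ : phi = \sum_j (fun y => phi y 0 j *: delta_mx 0 j)).
  by apply: differentiable_sum => j; exact: differentiableZl.
by apply/funext => y; rewrite fct_sumE {1}[phi y]row_sum_delta.
Qed.

(** The chain rule in partial derivatives, which are what the inductive
    definition of class C^k speaks of. *)
Lemma derive_row_comp (f : 'rV[R]_n -> R) (phi : 'rV[R]_m -> 'rV[R]_n) x v :
  differentiable f (phi x) ->
  (forall j, differentiable (fun y => phi y 0 j) x) ->
  'D_v (f \o phi) x =
  \sum_j 'D_(delta_mx 0 j) f (phi x) * 'D_v (fun y => phi y 0 j) x.
Proof.
move=> df dphi; have dp := differentiable_row dphi.
rewrite deriveE; last exact: differentiable_comp.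
rewrite diff_comp //= [X in 'd f _ X]row_sum_delta linear_sum.
apply: eq_bigr => j _; rewrite linearZ /= -(deriveE _ df) mulrC; congr (_ * _).
rewrite (deriveE _ (dphi j)).
have dc : differentiable (fun u : 'rV[R]_n => u 0 j : R) (phi x).
  exact: differentiable_coord.
by rewrite -[LHS](diff_coord (phi x)) (diff_comp dp dc).
Qed.

(** Induction on k: each partial derivative of the composite is, by the chain
    rule, a sum of products of a C^(k-1) composite and a smooth function. *)
Lemma Ck_on_comp k (U : set 'rV[R]_m) (V : set 'rV[R]_n)
    (f : 'rV[R]_n -> R) (phi : 'rV[R]_m -> 'rV[R]_n) :
  open U -> (forall x, U x -> V (phi x)) ->
  Ck_on k V f -> (forall j, smooth_on U (fun x => phi x 0 j)) ->
  Ck_on k U (f \o phi).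
Proof.
move=> oU UV + sphi.
have dphi x : U x -> forall j, differentiable (fun y => phi y 0 j) x.
  by move=> Ux j; exact: (sphi j 1%N).1.
elim: k f => [|k IH] f /=.
  move=> fV x Ux; apply: continuous_comp.
    exact/differentiable_continuous/differentiable_row/dphi.
  exact/fV/UV.
move=> [df Df]; split=> [x Ux|i].
  by apply: differentiable_comp; [exact/differentiable_row/dphi|exact/df/UV].
apply: (@Ck_on_eq _ _ _ _ (fun x => \sum_j 'D_(delta_mx 0 j) f (phi x) *
   'D_(delta_mx 0 i) (fun y => phi y 0 j) x)) => //.
  by move=> x Ux; rewrite derive_row_comp //; [exact/df/UV|exact: dphi].
apply: Ck_on_sum => // j; apply: Ck_on_mul => //; first exact: IH (Df j).
exact: (sphi j k.+1).2.
Qed.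

End Composition.

(** * Smooth functions, tangent vectors and metrics on a manifold *)

Section SmoothFunctions.
Variables (R : realType) (n : nat) (M : manifoldType R n).

Lemma open_chart_image (c : chart R n M) :
  @atlas R n M c -> open (coord c @` dom c).
Proof. by move=> Ac; have [ic _ _] := @atlasP R n M; have [] := ic c Ac. Qed.

Lemma smooth_funB (f h : M -> R) :
  smooth_fun f -> smooth_fun h -> smooth_fun (fun p => f p - h p).
Proof.
move=> sf sh c Ac k; have oc := open_chart_image Ac.
apply: (@Ck_on_eq _ _ _ _
    (fun x => f (param c x) + (-1) * h (param c x))) => //.
  by move=> x _; rewrite mulN1r.
apply: Ck_on_add => //; first exact: sf.
by apply: Ck_on_mul => //; [exact: Ck_on_cst|exact: sh].
Qed.

Lemma tangent_spaceB (p : M) (u v : tvec M) :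
  tangent_space p u -> tangent_space p v -> tangent_space p (u - v).
Proof.
move=> [u0 ul um] [v0 vl vm].
have E f : (u - v) f = u f - v f by [].
split=> [f nf|b f h sf sh|f h sf sh]; rewrite !E.
- by rewrite u0 // v0 // subrr.
- by rewrite ul // vl // mulrBr opprD addrACA.
- by rewrite um // vm // mulrBl mulrBr opprD addrACA.
Qed.

Lemma smooth_vector_fieldB (X Y : M -> tvec M) :
  smooth_vector_field X -> smooth_vector_field Y ->
  smooth_vector_field (fun p => X p - Y p).
Proof.
move=> [tX sX] [tY sY]; split=> [p|f sf]; first exact: tangent_spaceB.
by apply: smooth_funB; [exact: sX|exact: sY].
Qed.

Lemma tangent_space0 (p : M) : tangent_space p (0 : tvec M).
Proof.
have E f : (0 : tvec M) f = 0 by [].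
by split=> *; rewrite !E ?mulr0 ?mul0r ?addr0.
Qed.

(** From 1 * 1 = 1, the Leibniz rule gives v(1) = 2 v(1). *)
Lemma tangent_cst (p : M) (v : tvec M) (a : R) :
  tangent_space p v -> v (fun=> a) = 0.
Proof.
move=> [v0 vl vm].
have s c : smooth_fun (fun _ : M => c : R) by move=> d Ad k; exact: Ck_on_cst.
have v1 : v (fun=> 1) = 0.
  have := vm _ _ (s 1) (s 1); rewrite !mulr1 mul1r.
  by move/eqP; rewrite -subr_eq subrr eq_sym => /eqP.
have v0' : v (fun=> 0) = 0.
  by have := vl (-1) _ _ (s 1) (s 1); rewrite mulr1 addNr v1 mulr0 addr0.
by have := vl a _ _ (s 1) (s 0); rewrite mulr1 addr0 v1 v0' mulr0 addr0.
Qed.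

Variable g : M -> tvec M -> tvec M -> R.
Hypothesis g_riem : riemannian_metric g.

Lemma metric0l p v : tangent_space p v -> g p 0 v = 0.
Proof.
have [_ gl _ _] := g_riem => tv; have t0 := tangent_space0 p.
have := gl p 1 0 0 v t0 t0 tv; rewrite scaler0 addr0 mul1r => /eqP.
by rewrite -subr_eq subrr eq_sym => /eqP.
Qed.

Lemma metricBl p u v w : tangent_space p u -> tangent_space p v ->
  tangent_space p w -> g p (u - v) w = g p u w - g p v w.
Proof.
have [_ gl _ _] := g_riem => tu tv tw.
by rewrite addrC -scaleN1r gl // mulN1r addrC.
Qed.

Lemma metric_eq0 p v : tangent_space p v -> g p v v = 0 -> v = 0.
Proof.
have [_ _ gp _] := g_riem => tv gv; apply: contrapT => v0.
by have := gp p v tv v0; rewrite gv ltxx.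
Qed.

Lemma metric_inj p u v : tangent_space p u -> tangent_space p v ->
  (forall w, tangent_space p w -> g p u w = g p v w) -> u = v.
Proof.
move=> tu tv E; have tuv := tangent_spaceB tu tv.
by apply/subr0_eq/(metric_eq0 tuv); rewrite metricBl // E // subrr.
Qed.

Variable nabla : (M -> tvec M) -> (M -> tvec M) -> (M -> tvec M).
Hypothesis nabla_lc : levi_civita g nabla.

(** A connection without torsion saves checking that a commutator of derivations
    is a derivation: the bracket is a difference of covariant derivatives. *)
Lemma lie_bracket_smooth (X Y : M -> tvec M) :
  smooth_vector_field X -> smooth_vector_field Y ->
  smooth_vector_field (lie_bracket X Y).
Proof.
have [[sn _ _ _] tors _] := nabla_lc => sX sY.
by rewrite -tors //; apply: smooth_vector_fieldB; apply: sn.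
Qed.

End SmoothFunctions.

Lemma lie_bracketN (R : realType) (n : nat) (M : manifoldType R n)
    (X Y : M -> tvec M) : lie_bracket X Y = fun p => - lie_bracket Y X p.
Proof. by apply/funext => p; apply/funext => f; rewrite /lie_bracket opprB. Qed.

(** * Left translations of a Lie group *)

Section LieGroupTheory.
Variables (R : realType) (n : nat) (G : lieGroupType R n).

Lemma open_ltrans_chart (c d : chart R n G) (a : G) :
  @atlas R n G c -> @atlas R n G d ->
  open (coord c @` dom c `&` [set y | dom d (a * param c y)%g]).
Proof.
move=> Ac Ad; have [ic _ _] := @atlasP R n G.
have [_ oc _ _ cc] := ic c Ac; have [od _ _ _ _] := ic d Ad.
have [cmul _] := @mulg_smooth R n G.
rewrite openE => x [cx dx]; apply: filterI.
  by move: oc; rewrite openE; exact.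
have cont : {for x, continuous (fun y => a * param c y)%g}.
  apply: (@continuous_comp _ _ _ (fun y => (a, param c y))
    (fun z : G * G => z.1 * z.2)%g); last exact: cmul.
  exact: cvg_pair (cvg_cst a) (cc x cx).
by apply: cont; move: od; rewrite openE; exact.
Qed.

(** Smoothness of the multiplication concerns functions on R^(n + n), in a
    product chart around (a, x); composing with the affine slice that fixes the first
    n coordinates to those of a gives the left translation. *)
Lemma smooth_ltrans_coord (c d : chart R n G) (a : G) (j : 'I_n) :
  @atlas R n G c -> @atlas R n G d ->
  smooth_on (coord c @` dom c `&` [set y | dom d (a * param c y)%g])
    (fun x => coord d (a * param c x)%g 0 j).
Proof.
move=> Ac Ad k; have [ic cov _] := @atlasP R n G.
have [b Ab ba] := cov a; have [_ _ bK _ _] := ic b Ab.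
have [_ _ cK _ _] := ic c Ac.
have [_ /(_ (prod_chart b c) d) smul] := @mulg_smooth R n G.
have oW := @open_ltrans_chart c d a Ac Ad.
have Abc : prod_atlas (@atlas R n G) (@atlas R n G) (prod_chart b c).
  by exists b, c.
have sj := smul Abc Ad j k.
(* the slice x |-> (a, x), in coordinates *)
pose phi (x : 'rV[R]_n) := row_mx (coord b a) x.
set h := (X in Ck_on k _ X) in sj.
suff -> : (fun x => coord d (a * param c x)%g 0 j) = h \o phi.
  apply: Ck_on_comp sj _ => //.
    move=> _ [[p cp <-] dp]; exists (a, p) => //.
    by move: dp; rewrite /= cK.
  move=> i l.
  case: (split_ordP i) => i' ->.
    suff -> : (fun x => phi x 0 (lshift n i')) = (fun=> coord b a 0 i').
      exact: Ck_on_cst.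
    by apply/funext => x; rewrite row_mxEl.
  suff -> : (fun x => phi x 0 (rshift n i')) = (fun x => x 0 i').
    exact: Ck_on_coord.
  by apply/funext => x; rewrite row_mxEr.
by apply/funext => x; rewrite /h /phi /= row_mxKl row_mxKr bK.
Qed.

(** Around a p, f is read in a chart d; a single d need not contain the whole
    translate of the domain of c, hence the argument point by point. *)
Lemma smooth_fun_ltrans (f : G -> R) (a : G) :
  smooth_fun f -> smooth_fun (fun x => f (a * x)%g).
Proof.
move=> sf c Ac k; have [ic cov _] := @atlasP R n G.
have [_ _ cK _ _] := ic c Ac.
apply: Ck_on_cover => _ [p cp <-].
have [d Ad dap] := cov (a * p)%g; have [_ _ dK _ _] := ic d Ad.
have oW := @open_ltrans_chart c d a Ac Ad.
apply: (@Ck_on_sub _ _ _ _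
    (coord c @` dom c `&` [set y | dom d (a * param c y)%g])).
  by move=> _ ->; split; [exists p|rewrite /= cK].
apply: (@Ck_on_eq _ _ _ _
    ((f \o param d) \o (fun y => coord d (a * param c y)%g))) => //.
  by move=> y [_ dy] /=; rewrite dK.
apply: Ck_on_comp (sf d Ad k) _ => //.
  by move=> y [_ dy]; exists (a * param c y)%g.
by move=> j; exact: smooth_ltrans_coord.
Qed.

Lemma dltransK (a : G) (v : tvec G) : dltrans a (dltrans (a^-1)%g v) = v.
Proof.
by apply/funext => f; rewrite /dltrans; congr (v _); apply/funext => x;
  rewrite mulgA mulgV mul1g.
Qed.

(** A function f that is not smooth has to be sent to 0: translating back by the
    inverse of a shows that f(a x) is not smooth either. *)
Lemma tangent_dltrans (a x : G) (v : tvec G) :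
  tangent_space x v -> tangent_space (a * x)%g (dltrans a v).
Proof.
move=> [v0 vl vm]; split=> [f nf|b f h sf sh|f h sf sh]; rewrite /dltrans.
- apply: v0 => sf; apply: nf.
  have := smooth_fun_ltrans (a^-1)%g sf.
  suff -> : (fun y => f (a * (a^-1 * y))%g) = f by [].
  by apply/funext => y; rewrite mulgA mulgV mul1g.
- exact: (vl b _ _ (smooth_fun_ltrans a sf) (smooth_fun_ltrans a sh)).
- exact: (vm _ _ (smooth_fun_ltrans a sf) (smooth_fun_ltrans a sh)).
Qed.

Lemma lie_bracket_left_invariant (X Y : G -> tvec G) :
  left_invariant_field X -> left_invariant_field Y ->
  left_invariant_field (lie_bracket X Y).
Proof.
move=> iX iY a x; apply/funext => f.
rewrite /lie_bracket /dltrans iX iY /dltrans.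
by congr (X x _ - Y x _); apply/funext => q; rewrite ?iX ?iY.
Qed.

(** * Left invariant metrics and parallel fields *)

Variable g : G -> tvec G -> tvec G -> R.
Hypotheses (g_riem : riemannian_metric g) (g_inv : left_invariant_metric g).

Lemma metric_left_invariant_cst (X Y : G -> tvec G) p :
  lie_algebra G X -> lie_algebra G Y ->
  g p (X p) (Y p) = g 1%g (X 1%g) (Y 1%g).
Proof.
move=> [[tX _] iX] [[tY _] iY].
by rewrite -[p in LHS]mulg1 iX iY g_inv.
Qed.

(** The Riemannian part of the Randers metric being left invariant, so is the
    1-form g(X, _), which determines X. *)
Lemma randers_left_invariant (X : G -> tvec G) :
  smooth_vector_field X -> left_invariant_finsler (randers g X) ->
  left_invariant_field X.
Proof.
move=> [tX _] Finv.
have XE a : X a = dltrans a (X 1%g).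
  have tX1 : tangent_space a (dltrans a (X 1%g)).
    by rewrite -[a in tangent_space a]mulg1; exact: tangent_dltrans.
  apply: (metric_inj g_riem) => // v tv.
  have tv1 : tangent_space 1%g (dltrans (a^-1)%g v).
    by rewrite -(mulVg a); exact: tangent_dltrans.
  have gE u : tangent_space 1%g u ->
      g a (dltrans a u) v = g 1%g u (dltrans (a^-1)%g v).
    by move=> tu; rewrite -{1}(mulg1 a) -{1}(dltransK a v) g_inv.
  have gvv : g a v v = g 1%g (dltrans (a^-1)%g v) (dltrans (a^-1)%g v).
    by rewrite -gE // dltransK.
  by have := Finv a v tv; rewrite /randers gvv gE // => /addrI.
move=> a x; rewrite XE [X x]XE.
by apply/funext => f; rewrite /dltrans; congr (X _ _); apply/funext => y;
  rewrite mulgA.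
Qed.

Lemma derive_metric_left_invariant (Y X Z : G -> tvec G) p :
  smooth_vector_field Y -> lie_algebra G X -> lie_algebra G Z ->
  Y p (fun q => g q (X q) (Z q)) = 0.
Proof.
move=> [tY _] LX LZ.
rewrite (_ : (fun q => g q (X q) (Z q)) = fun=> g 1%g (X 1%g) (Z 1%g)).
  exact: tangent_cst (tY p).
by apply/funext => q; exact: metric_left_invariant_cst.
Qed.

Variable nabla : (G -> tvec G) -> (G -> tvec G) -> (G -> tvec G).
Hypothesis nabla_lc : levi_civita g nabla.

Lemma lie_algebra_bracket (X Y : G -> tvec G) :
  lie_algebra G X -> lie_algebra G Y -> lie_algebra G (lie_bracket X Y).
Proof.
move=> [sX iX] [sY iY]; split; first exact: lie_bracket_smooth nabla_lc _ _ _ _.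
exact: lie_bracket_left_invariant.
Qed.

Variable X : G -> tvec G.
Hypotheses (LX : lie_algebra G X)
  (X_par : forall Y, smooth_vector_field Y -> nabla Y X = (fun=> 0)).

(** D_U V is orthogonal to X: differentiate the constant g(V, X) along U and use
    D_U X = 0. *)
Lemma parallel_orthogonal_bracket (Y Z : G -> tvec G) p :
  lie_algebra G Y -> lie_algebra G Z -> g p (lie_bracket Y Z p) (X p) = 0.
Proof.
have [[sn _ _ _] tors compat] := nabla_lc.
have [gs _ _ _] := g_riem => LY LZ; have [sX iX] := LX.
have nX U V : lie_algebra G U -> lie_algebra G V ->
    g p (nabla U V p) (X p) = 0.
  move=> LU LV; have [sU _] := LU; have [sV _] := LV.
  have := compat U V X sU sV sX p.
  rewrite derive_metric_left_invariant // X_par // => /esym.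
  have tV := sV.1 p.
  by rewrite (gs p (V p)) // ?(metric0l g_riem) ?addr0 //; exact: tangent_space0.
have [sY _] := LY; have [sZ _] := LZ.
rewrite -(tors _ _ sY sZ) (metricBl g_riem); first by rewrite !nX // subrr.
- exact: (sn _ _ sY sZ).1.
- exact: (sn _ _ sZ sY).1.
- exact: sX.1.
Qed.

(** As D_X Y = [X, Y], the operator ad X is skew for g; its square vanishes,
    hence so does |[X, Y]|^2. *)
Lemma parallel_central : two_step_nilpotent G -> lie_center G X.
Proof.
move=> [_ nil]; have [_ tors compat] := nabla_lc.
have [gs _ _ _] := g_riem; have [sX _] := LX.
have nXE Y : smooth_vector_field Y -> nabla X Y = lie_bracket X Y.
  by move=> sY; rewrite -tors // X_par //; apply/funext => p; rewrite subr0.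
split=> // Y LY; have LXY := lie_algebra_bracket LX LY.
have [sY _] := LY; have [sXY _] := LXY; apply/funext => p.
apply: (metric_eq0 g_riem (sXY.1 p)).
(* 0 = X g(Y, [X, Y]) = |[X, Y]|^2 + g(Y, [X, [X, Y]]) *)
have := compat X Y _ sX sY sXY p.
rewrite derive_metric_left_invariant // nXE // nXE // nil //.
have t0 := tangent_space0 p.
by rewrite (gs p (Y p) 0) ?(metric0l g_riem) ?addr0 //; exact: sY.1.
Qed.

(** A nonzero X spans the center, which contains all brackets; but X is
    orthogonal to the brackets, so they would all vanish. *)
Lemma parallel_eq0 :
  two_step_nilpotent G -> one_dimensional_center G -> X = (fun=> 0).
Proof.
move=> Gnil [Z [_ _ Zspan]]; apply: contrapT => X0.
have [aX XE] := Zspan _ (parallel_central Gnil).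
have [[U [V [LU LV UV0]]] nil] := Gnil; apply: UV0.
have LUV := lie_algebra_bracket LU LV.
have cUV : lie_center G (lie_bracket U V).
  split=> // Y LY; rewrite lie_bracketN nil //.
  by apply/funext => p; rewrite oppr0.
have [b UVE] := Zspan _ cUV.
have aX0 : aX != 0.
  apply/eqP => a0; apply: X0; rewrite XE a0.
  by apply/funext => p; rewrite scale0r.
have UVX p : lie_bracket U V p = (b / aX) *: X p.
  by rewrite UVE XE scalerA divfK.
apply/funext => p; have tUV := LUV.1.1 p; have tX := LX.1.1 p.
apply: (metric_eq0 g_riem tUV).
have [gs gl _ _] := g_riem.
rewrite {1}UVX -[_ *: _]addr0 gl //; last exact: tangent_space0.
by rewrite (metric0l g_riem) // addr0 gs // parallel_orthogonal_bracket // mulr0.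
Qed.

End LieGroupTheory.

Theorem proposition3p2 (R : realType) (N : lieGroupType R 5)
  (N_sc : simply_connected R N)
  (N_nil : two_step_nilpotent N)
  (N_center : one_dimensional_center N)
  (g : N -> tvec N -> tvec N -> R)
  (g_riem : riemannian_metric g)
  (g_inv : left_invariant_metric g)
  (X : N -> tvec N)
  (X_field : smooth_vector_field X)
  (X_neq0 : X <> (fun=> 0))
  (X_lt1 : forall p, Num.sqrt (g p (X p) (X p)) < 1) :
  ~ (left_invariant_finsler (randers g X) /\ randers_berwald g X).
Proof.
move=> [Finv [nabla nabla_lc X_par]]; apply: X_neq0.
have LX : lie_algebra N X.
  by split=> //; exact: randers_left_invariant g_riem g_inv _ X_field Finv.
exact: (parallel_eq0 g_riem g_inv nabla_lc LX X_par N_nil N_center).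
Qed.
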